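(* Let $n\ge 1$, let $\mathcal X_1,\dots,\mathcal X_n$ be sets, and for each $i$ let $\Pi_i$ be a possibility measure on $\mathcal X_i$ with possibility distribution $\pi_i$ whose range is $\pi_i(\mathcal X_i)=[0,1]$. Let $\Omega=\mathcal X_1\times\dots\times\mathcal X_n$ be equipped with the total preorder $\preceq$ defined by $x\preceq y$ iff $Z(x)\le Z(y)$, where $Z(x_1,\dots,x_n)=\max_{i=1}^n\pi_i(x_i)$. Then the possibility distribution on $\Omega$ given by $$\pi(x)=\max_{i=1}^n\pi_i(x_i)$$ induces the least conservative upper cumulative distribution function on $(\Omega,\preceq)$ that dominates the natural extension $\boxtimes_{i=1}^n\Pi_i$ of $\Pi_1,\dots,\Pi_n$. That is: $\pi$ is a possibility distribution, and the function $\overline F(x)=\sup_{y\preceq x}\pi(y)$ is the pointwise smallest among all cumulative distribution functions on $(\Omega,\preceq)$ that dominate $\boxtimes_{i=1}^n\Pi_i$.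
   Context: A possibility distribution on a set is a $[0,1]$-valued map $\pi$ with supremum $1$; its possibility measure is $\Pi(A)=\sup_{x\in A}\pi(x)$ for every subset $A$ (with $\sup\emptyset=0$). A cumulative distribution function on a totally preordered space $(\Omega,\preceq)$ with smallest element $0_\Omega$ and largest element $1_\Omega$ is a non-decreasing map $F:\Omega\to[0,1]$ with $F(1_\Omega)=1$. It is said to dominate an upper probability $Q$ (defined on all subsets of $\Omega$) if $\overline E_F(A)\ge Q(A)$ for all $A\subseteq\Omega$, where $\overline E_F(A)$ is the supremum of $P(A)$ over all finitely additive probabilities $P$ on the power set of $\Omega$ satisfying $P([0_\Omega,x])\le F(x)$ for all $x\in\Omega$, with $[0_\Omega,x]=\{z:z\preceq x\}$ (this is the natural extension of the p-box with vacuous lower cumulative distribution function and upper cumulative distribution function $F$). The natural extension $\boxtimes_{i=1}^n\Pi_i$ of the marginals is the upper envelope of all joint finitely additive probabilities with compatible marginals: for $A\subseteq\Omega$, $(\boxtimes_{i=1}^n\Pi_i)(A)=\sup P(A)$ over all finitely additive probabilities $P$ on the power set of $\Omega$ such that $P(\{x\in\Omega:x_i\in A_i\})\le\Pi_i(A_i)$ for all $i$ and all $A_i\subseteq\mathcal X_i$. (It satisfies the known Fréchet bound $(\boxtimes_{i=1}^n\Pi_i)(\prod_{i=1}^nA_i)=\min_{i=1}^n\Pi_i(A_i)$.) *)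

(* Defs.v *)
From mathcomp Require Import all_boot all_order all_algebra.
From mathcomp Require Import all_classical all_reals.

Set Implicit Arguments.
Unset Strict Implicit.
Unset Printing Implicit Defensive.

Import Order.TTheory GRing.Theory Num.Theory.
Local Open Scope classical_set_scope.
Local Open Scope ring_scope.

Definition possibility_distribution (R : realType) (T : Type) (pi : T -> R) :
  Prop := (forall x, 0 <= pi x <= 1) /\ sup (range pi) = 1.

(* The library's [sup] returns 0 on the empty set, as required here. *)
Definition possibility_measure (R : realType) (T : Type) (pi : T -> R)
  (A : set T) : R := sup [set pi x | x in A].

Definition finitely_additive_probability (R : realType) (T : Type)
    (P : set T -> R) : Prop :=
  [/\ forall A, 0 <= P A,
      P setT = 1
    & forall A B, A `&` B = set0 -> P (A `|` B) = P A + P B].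

Definition bounded_total_preorder (T : Type) (le : rel T) : Prop :=
  [/\ reflexive le, transitive le, total le,
      exists b, forall x, le b x
    & exists t, forall x, le x t].

(* A largest element of a preorder need not be unique; the normalization is
   required at each of them, all being equivalent and thus having the same
   image under a non-decreasing map. *)
Definition is_cdf (R : realType) (T : Type) (le : rel T) (F : T -> R) : Prop :=
  [/\ forall x, 0 <= F x <= 1,
      forall x y, le x y -> F x <= F y
    & forall t, (forall x, le x t) -> F t = 1].

(* The interval from the smallest element to x. *)
Definition down_set (T : Type) (le : rel T) (x : T) : set T :=
  [set z | le z x].

(* For a nonempty set of finitely additive probabilities, the values P A lie
   in [0, 1], so that this real [sup] is a genuine supremum. *)
Definition upper_envelope (R : realType) (T : Type) (M : set (set T -> R))
  (A : set T) : R := sup [set P A | P in M].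

Definition pbox_natural_extension (R : realType) (T : Type) (le : rel T)
    (F : T -> R) : set T -> R :=
  upper_envelope [set P | finitely_additive_probability P /\
                          forall x, P (down_set le x) <= F x].

Definition dominates (R : realType) (T : Type) (le : rel T) (F : T -> R)
  (Q : set T -> R) : Prop := forall A, Q A <= pbox_natural_extension le F A.

Definition marginal_natural_extension (R : realType) (n : nat)
    (X : 'I_n -> Type) (Pi : forall i, set (X i) -> R) :
    set (forall i, X i) -> R :=
  upper_envelope
    [set P | finitely_additive_probability P /\
             forall (i : 'I_n) (A : set (X i)),
               P [set x : forall j, X j | A (x i)] <= Pi i A].

(* The neutral element 0 is harmless: n is positive and the values of the
   pi i are nonnegative wherever this is used. *)
Definition max_joint (R : realType) (n : nat) (X : 'I_n -> Type)
    (pi : forall i, X i -> R) (x : forall i, X i) : R :=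
  \big[Num.max/0]_(i < n) pi i (x i).

Definition preorder_of (R : realType) (T : Type) (Z : T -> R) : rel T :=
  fun x y => Z x <= Z y.

Definition induced_cdf (R : realType) (T : Type) (le : rel T) (pi : T -> R)
  (x : T) : R := possibility_measure pi (down_set le x).

(* Main.v *)
(* Full range makes [Fbar = Z].  [Fbar] dominates because any joint P satisfies
   P (Z <= c) <= P (pi_0 <= c) <= c, so it belongs to the credal set of the
   p-box.  For minimality, choose u and v with all marginal possibilities equal
   to c = Z x and to 1 respectively: c delta_u + (1 - c) delta_v has marginals
   dominated by the Pi_i and gives [0, x] mass at least c. *)
Require Import Defs.
From mathcomp Require Import all_boot all_order all_algebra.
From mathcomp Require Import all_classical all_reals.

Set Implicit Arguments.
Unset Strict Implicit.
Unset Printing Implicit Defensive.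

Import Order.TTheory GRing.Theory Num.Theory.
Local Open Scope classical_set_scope.
Local Open Scope ring_scope.

(** When [E] is empty or unbounded above, [sup E] takes the default value 0, which agrees with the
    bound. *)
Lemma sup_ge0 (R : realType) (E : set R) : 
  (forall x, E x -> 0 <= x) -> 0 <= sup E.
Proof.
move=> E0; have [[[x Ex] ubE]|nE] := pselect (has_sup E).
  by apply: le_trans (E0 _ Ex) _; exact: ub_le_sup.
by rewrite sup_out.
Qed.

Lemma finitely_additive_probability_le1 (R : realType) (T : Type)
    (P : set T -> R) (A : set T) :
  finitely_additive_probability P -> P A <= 1.
Proof.
by case=> P0 P1 PU; rewrite -P1 -(setUv A) PU ?setICr// lerDl.
Qed.

Lemma finitely_additive_probability_le (R : realType) (T : Type)
    (P : set T -> R) (A B : set T) :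
  finitely_additive_probability P -> A `<=` B -> P A <= P B.
Proof.
case=> P0 _ PU AB.
by rewrite -(setDUK AB) PU ?lerDl// setDE setICA setICr setI0.
Qed.

Lemma has_ubound_finitely_additive_probability (R : realType) (T : Type)
    (M : set (set T -> R)) (A : set T) :
  M `<=` @finitely_additive_probability R T ->
  has_ubound [set P A | P in M].
Proof.
move=> MP; exists 1 => _ [P /MP fP <-].
exact: finitely_additive_probability_le1.
Qed.

Lemma upper_envelope_ge (R : realType) (T : Type) (M : set (set T -> R))
    (P : set T -> R) (A : set T) :
  M `<=` @finitely_additive_probability R T -> M P -> P A <= upper_envelope M A.
Proof.
move=> MP Mp; apply: ub_le_sup; last by exists P.
exact: has_ubound_finitely_additive_probability.
Qed.

(** The condition [0 <= r] covers an empty [M], whose envelope is the default value 0. *)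
Lemma upper_envelope_le (R : realType) (T : Type) (M : set (set T -> R))
    (A : set T) (r : R) :
  0 <= r -> (forall P, M P -> P A <= r) -> upper_envelope M A <= r.
Proof.
move=> r0 Mr; rewrite /upper_envelope.
have [->|/set0P ne] := eqVneq [set P A | P in M] set0; first by rewrite sup0.
by apply: ge_sup => // _ [P MP <-]; exact: Mr.
Qed.

Lemma upper_envelope_ge0 (R : realType) (T : Type) (M : set (set T -> R))
    (A : set T) :
  M `<=` @finitely_additive_probability R T -> 0 <= upper_envelope M A.
Proof.
by move=> MP; apply: sup_ge0 => _ [P /MP[P0 _ _] <-].
Qed.

Lemma upper_envelopeS (R : realType) (T : Type) (M N : set (set T -> R))
    (A : set T) :
  N `<=` @finitely_additive_probability R T -> M `<=` N ->
  upper_envelope M A <= upper_envelope N A.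
Proof.
move=> NP MN; apply: upper_envelope_le; first exact: upper_envelope_ge0.
by move=> P /MN; exact: upper_envelope_ge.
Qed.

Lemma possibility_measure_ge (R : realType) (T : Type) (pi : T -> R)
    (A : set T) (x : T) :
  (forall y, pi y <= 1) -> A x -> pi x <= possibility_measure pi A.
Proof.
move=> pi1 Ax; apply: ub_le_sup; last by exists x.
by exists 1 => _ [y _ <-].
Qed.

Lemma possibility_measure_le (R : realType) (T : Type) (pi : T -> R)
    (A : set T) (r : R) :
  0 <= r -> (forall x, A x -> pi x <= r) -> possibility_measure pi A <= r.
Proof.
move=> r0 Ar; rewrite /possibility_measure.
have [->|/set0P ne] := eqVneq [set pi x | x in A] set0; first by rewrite sup0.
by apply: ge_sup => // _ [x Ax <-]; exact: Ar.
Qed.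

Lemma possibility_measure_ge0 (R : realType) (T : Type) (pi : T -> R)
    (A : set T) :
  (forall x, 0 <= pi x) -> 0 <= possibility_measure pi A.
Proof. by move=> pi0; apply: sup_ge0 => _ [x _ <-]. Qed.

(** The supremum over the down-set of [x] is attained at [x] itself. *)
Lemma induced_cdf_id (R : realType) (T : Type) (Z : T -> R) (x : T) :
  (forall y, 0 <= Z y <= 1) -> induced_cdf (preorder_of Z) Z x = Z x.
Proof.
move=> Z01; apply/le_anti/andP; split.
  by apply: possibility_measure_le => [|//]; case/andP: (Z01 x).
apply: possibility_measure_ge => [y|]; first by case/andP: (Z01 y).
exact: lexx.
Qed.

Definition two_point_mass (R : realType) (T : Type) (c : R) (u v : T)
  (A : set T) : R := c * (`[< A u >])%:R + (1 - c) * (`[< A v >])%:R.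

Lemma two_point_mass_probability (R : realType) (T : Type) (c : R) (u v : T) :
  0 <= c <= 1 -> finitely_additive_probability (two_point_mass c u v).
Proof.
move=> /andP[c0 c1]; rewrite /two_point_mass; split.
- by move=> A; rewrite addr_ge0// mulr_ge0// subr_ge0.
- by rewrite !asboolT// !mulr1 addrC subrK.
move=> A B AB0.
have indU w : (`[< (A `|` B) w >])%:R = (`[< A w >])%:R + (`[< B w >])%:R :> R.
  rewrite asbool_or; case: asboolP => Aw; case: asboolP => Bw /=;
    rewrite ?addr0 ?add0r//.
  by have : (A `&` B) w by []; rewrite AB0.
by rewrite !indU !mulrDr addrACA.
Qed.

(** If [A] contains [f v], its possibility is 1, which bounds any mass. Otherwise only [u] can
    contribute: the mass is at most [c], and it is [c] only when [A] contains [f u], a point of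
    possibility [c]. *)
Lemma two_point_mass_le_possibility (R : realType) (T S : Type) (f : T -> S)
    (pi : S -> R) (c : R) (u v : T) (A : set S) :
  (forall y, 0 <= pi y <= 1) -> 0 <= c <= 1 -> pi (f u) = c -> pi (f v) = 1 ->
  two_point_mass c u v [set x | A (f x)] <= possibility_measure pi A.
Proof.
move=> pi01 /andP[c0 c1] piu piv; rewrite /two_point_mass.
have pi1 y : pi y <= 1 by case/andP: (pi01 y).
have [Av|nAv] := pselect (A (f v)).
  apply: le_trans (possibility_measure_ge pi1 Av); rewrite piv.
  (* Writing the bound 1 as [1 - c + c] leaves [c] times an indicator to compare with [c]. *)
  rewrite (asboolT Av) mulr1 addrC -[leRHS](subrK c) lerD2l.
  by rewrite ler_piMr// lern1; case: asbool.
rewrite (asboolF nAv) mulr0 addr0.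
have [Au|nAu] := pselect (A (f u)).
  by rewrite (asboolT Au) mulr1 -piu; exact: possibility_measure_ge.
rewrite (asboolF nAu) mulr0; apply: possibility_measure_ge0 => y.
by case/andP: (pi01 y).
Qed.

Section MaxJoint.
Variables (R : realType) (n : nat) (X : 'I_n -> Type).
Variable pi : forall i : 'I_n, X i -> R.

Lemma max_joint_ge0 x : 0 <= max_joint pi x.
Proof. exact: bigmax_ge_id. Qed.

Lemma max_joint_ge i x : pi (x i) <= max_joint pi x.
Proof. exact: (le_bigmax _ (fun j => pi (x j))). Qed.

Lemma max_joint_le c x :
  0 <= c -> (forall i, pi (x i) <= c) -> max_joint pi x <= c.
Proof. by move=> c0 xc; apply: bigmax_le. Qed.

(** The lower bound is read off at an actual index; over an empty family the maximum would be the
    neutral element 0. *)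
Lemma max_joint_const c x :
  (0 < n)%N -> 0 <= c -> (forall i, pi (x i) = c) -> max_joint pi x = c.
Proof.
move=> n0 c0 xc; apply/le_anti/andP; split.
  by apply: max_joint_le => // i; rewrite xc.
by rewrite -[leLHS](xc (Ordinal n0)) max_joint_ge.
Qed.

(** Full range gives a preimage of [c] in each coordinate, and choice assembles these into one point
    of the product. *)
Lemma exists_const_possibility c :
  (forall i, range (@pi i) = `[0, 1]%classic) -> 0 <= c <= 1 ->
  exists x : forall i, X i, forall i, pi (x i) = c.
Proof.
move=> rng c01.
have ex i : exists y : X i, pi y = c.
  have : (`[0, 1]%classic : set R) c by rewrite /= in_itv.
  by rewrite -(rng i) => -[y _ <-]; exists y.
by exists (fun i => projT1 (cid (ex i))) => i; case: cid.
Qed.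

End MaxJoint.

Theorem theorem28 (R : realType) (n : nat) (n_ge1 : (1 <= n)%N)
    (X : 'I_n -> Type) (pi : forall i : 'I_n, X i -> R)
    (pi_poss : forall i, possibility_distribution (pi i))
    (pi_range : forall i, range (pi i) = `[0, 1]%classic) :
  let Z := max_joint pi in
  let le := preorder_of Z in
  let Q := marginal_natural_extension
             (fun i => possibility_measure (pi i)) in
  let Fbar := induced_cdf le (max_joint pi) in
  [/\ bounded_total_preorder le,
      possibility_distribution (max_joint pi),
      is_cdf le Fbar,
      dominates le Fbar Q
    & forall F : (forall i, X i) -> R,
        is_cdf le F -> dominates le F Q -> forall x, Fbar x <= F x].
Proof.
move=> Z le Q Fbar.
have pi01 i y : 0 <= pi i y <= 1 by case: (pi_poss i).
have Z01 x : 0 <= Z x <= 1.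
  rewrite max_joint_ge0 max_joint_le// => i.
  by case/andP: (pi01 i (x i)).
have FbarE x : Fbar x = Z x by exact: induced_cdf_id.
(* The points [b] and [t] are a smallest and a largest element; [t] also carries the second atom in
   the minimality argument. *)
have [b pib] : exists x : forall i, X i, forall i, pi i (x i) = 0.
  by apply: exists_const_possibility; rewrite // lexx ler01.
have [t pit] : exists x : forall i, X i, forall i, pi i (x i) = 1.
  by apply: exists_const_possibility; rewrite // lexx ler01.
have Zb : Z b = 0 by exact: max_joint_const.
have Zt : Z t = 1 by exact: max_joint_const.
split.
- split; rewrite /le /preorder_of.
  + by move=> x; exact: lexx.
  + by move=> y x z; exact: le_trans.
  + by move=> x y; exact: le_total.
  + by exists b => x; rewrite Zb; case/andP: (Z01 x).
  + by exists t => x; rewrite Zt; case/andP: (Z01 x).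
- split=> //; apply/le_anti/andP; split.
    by apply: ge_sup => [|_ [x _ <-]]; [exists (Z t), t|case/andP: (Z01 x)].
  rewrite -[leLHS]Zt; apply: ub_le_sup; last by exists t.
  by exists 1 => _ [x _ <-]; case/andP: (Z01 x).
- split=> [x|x y xy|x xmax]; rewrite !FbarE//.
  (* Any largest element lies above [t], where [Z] is 1. *)
  apply/le_anti/andP; split; first by case/andP: (Z01 x).
  by rewrite -Zt; exact: xmax.
(* Domination follows from inclusion of credal sets. A single coordinate [i0] suffices: the sublevel
   set of the maximum lies in a cylinder over [i0], to which the marginal constraint applies. *)
- move=> A; apply: upper_envelopeS => [P []//|P [fP Ppi]].
  split=> // x; rewrite FbarE; pose i0 := Ordinal n_ge1.
  apply: (le_trans (finitely_additive_probability_le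
    (B := [set y : forall j, X j | pi i0 (y i0) <= Z x]) fP _)).
    by move=> y; exact: le_trans (max_joint_ge pi i0 y).
  apply: le_trans (Ppi i0 [set w | pi i0 w <= Z x]) _.
  by apply: possibility_measure_le => //; exact: max_joint_ge0.
move=> F [F01 _ _] domF x; rewrite FbarE.
have [u piu] : exists u : forall i, X i, forall i, pi i (u i) = Z x.
  exact: exists_const_possibility.
have Zu : Z u = Z x by apply: max_joint_const => //; exact: max_joint_ge0.
have Mass : two_point_mass (Z x) u t (down_set le x) <= Q (down_set le x).
  apply: upper_envelope_ge => [P []//|].
  split; first exact: two_point_mass_probability.
  by move=> i A; apply: (two_point_mass_le_possibility (f := fun y => y i)).
have c_le_mass : Z x <= two_point_mass (Z x) u t (down_set le x).
  (* The atom [u] lies in the down-set because [Z u = Z x]; the atom [t] can only add mass. *)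
  rewrite /two_point_mass asboolT; last by rewrite /down_set /le /preorder_of /= Zu.
  by rewrite mulr1 lerDl mulr_ge0// subr_ge0; case/andP: (Z01 x).
apply: le_trans c_le_mass (le_trans Mass (le_trans (domF _) _)).
(* The p-box constraint at [x] bounds each admissible [P] on this down-set by [F x]. *)
by apply: upper_envelope_le => [|P [_]]; [case/andP: (F01 x)|].
Qed.
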